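(* Let $\mathcal{B}=(\mathcal{O},\mathscr{C},\mathfrak{R},I,T)$ be a bud generating system such that $\mathcal{O}$ is a locally finite operad and $\mathfrak{R}(1)$ finitely factorizes $\mathbf{Bud}_{\mathscr{C}}(\mathcal{O})$. Then the synchronous generating series of $\mathcal{B}$ satisfies $$\mathrm{sync}(\mathcal{B})=\sum_{\substack{\mathfrak{t}\in\mathbf{Free}_{\mathrm{perf}}(\mathfrak{R})\\ \mathrm{out}(\mathfrak{t})\in I\\ \mathrm{in}(\mathfrak{t})\in T^+}}\mathrm{ev}_{\mathbf{Bud}_{\mathscr{C}}(\mathcal{O})}(\mathfrak{t}).$$
   Context: Colored operads. Let $\mathscr{C}$ be a finite set of colors. A $\mathscr{C}$-colored operad $\mathcal{C}=\bigsqcup_{n\geq1}\mathcal{C}(n)$ is a nonsymmetric colored set-operad: each $x\in\mathcal{C}(n)$ has arity $|x|=n$, an output color $\mathrm{out}(x)\in\mathscr{C}$ and a word of input colors $\mathrm{in}(x)\in\mathscr{C}^n$ with $i$-th letter $\mathrm{in}_i(x)$; $x\circ_i y\in\mathcal{C}(|x|+|y|-1)$ is defined iff $\mathrm{out}(y)=\mathrm{in}_i(x)$; there are units $\mathbf{1}_a\in\mathcal{C}(1)$, $a\in\mathscr{C}$, with output and input color $a$; the usual associativity and unit axioms hold. The complete composition is $x\circ[y_1,\dots,y_n]:=(\cdots((x\circ_n y_n)\circ_{n-1}y_{n-1})\cdots)\circ_1 y_1$ (defined when $\mathrm{out}(y_i)=\mathrm{in}_i(x)$ for all $i$). A (monochrome)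 operad is the case of a single color. $\mathcal{C}$ is locally finite if every $\mathcal{C}(n)$ is finite. Bud operads. For an operad $\mathcal{O}$ with unit $\mathbf{1}$, $\mathbf{Bud}_{\mathscr{C}}(\mathcal{O})$ is the $\mathscr{C}$-colored operad of triples $(a,x,u)\in\mathscr{C}\times\mathcal{O}(n)\times\mathscr{C}^n$, $n\geq1$, with output color $a$, input colors $u$, units $\mathbf{1}_a=(a,\mathbf{1},a)$, and $(a,x,u)\circ_i(b,y,v)=(a,x\circ_i y,u')$ when $b=u_i$, where $u'$ is $u$ with its $i$-th letter replaced by $v$. A bud generating system is a tuple $(\mathcal{O},\mathscr{C},\mathfrak{R},I,T)$ with $\mathcal{O}$ an operad, $\mathscr{C}$ a finite set of colors, $\mathfrak{R}$ a finite subset of $\mathbf{Bud}_{\mathscr{C}}(\mathcal{O})$ (rules) and $I,T\subseteq\mathscr{C}$. $T^+$ is the set of nonempty words on $T$. Trees. For a subset $S$ of a $\mathscr{C}$-colored operad $\mathcal{C}$, $S(1)$ is the set of its elements of arity $1$, and $\mathbf{Free}(S)$ is the set of $\mathscr{C}$-colored $S$-syntax trees: planar rooted trees whose internal nodes with $n\geq1$ children are labeled by arity-$n$ elements of $S$, such that if $v$ is the $i$-th child of $u$ (both internal) then the output color of the label of $v$ is the $i$-th input color of the label of $u$; it contains, for each color $a$, a tree consisting of one leaf with output and input color $a$. A tree is perfect if all paths connecting its root to its leaves have the same length (in particular one-leaf trees are perfect); $\mathbf{Free}_{\mathrm{perf}}(S)$ is the set of perfect trees of $\mathbf{Free}(S)$.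 $\mathrm{out}(\mathfrak{t})$ is the output color of the root label, and $\mathrm{in}(\mathfrak{t})$ is the word of input colors of the leaves from left to right. The evaluation $\mathrm{ev}_{\mathcal{C}}(\mathfrak{t})\in\mathcal{C}$ is obtained by composing in $\mathcal{C}$ the labels along $\mathfrak{t}$ (the one-leaf tree of color $a$ evaluates to $\mathbf{1}_a$). $S$ finitely factorizes $\mathcal{C}$ if for each $x\in\mathcal{C}$ there are finitely many $\mathfrak{t}\in\mathbf{Free}(S)$ with $\mathrm{ev}_{\mathcal{C}}(\mathfrak{t})=x$. Series. $\mathbb{K}$ is a field of characteristic zero. A $\mathcal{C}$-series is a map $\mathbf{f}:\mathcal{C}\to\mathbb{K}$, with values denoted $\langle x,\mathbf{f}\rangle$, written $\mathbf{f}=\sum_{x}\langle x,\mathbf{f}\rangle x$. The characteristic series of a subset is its indicator function. $\mathbf{u}$ is the characteristic series of $\{\mathbf{1}_a:a\in\mathscr{C}\}$. Composition product: $\langle x,\mathbf{f}\odot\mathbf{g}\rangle:=\sum_{y,z_1,\dots,z_{|y|}\in\mathcal{C},\,x=y\circ[z_1,\dots,z_{|y|}]}\langle y,\mathbf{f}\rangle\prod_{i}\langle z_i,\mathbf{g}\rangle$; on a locally finite colored operad it is associative with unit $\mathbf{u}$. $\mathbf{f}^{\odot_\ell}$ is the $\ell$-fold $\odot$-product of $\mathbf{f}$ with itself ($\mathbf{f}^{\odot_0}=\mathbf{u}$), and $\mathbf{f}^{\odot_*}:=\sum_{\ell\geq0}\mathbf{f}^{\odot_\ell}$. Let $\mathbf{r}$,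 $\mathbf{i}$, $\mathbf{t}$ be the characteristic series of $\mathfrak{R}$, $\{\mathbf{1}_a:a\in I\}$, $\{\mathbf{1}_a:a\in T\}$ in $\mathbf{Bud}_{\mathscr{C}}(\mathcal{O})$. The synchronous generating series is the $\mathbf{Bud}_{\mathscr{C}}(\mathcal{O})$-series $\mathrm{sync}(\mathcal{B}):=\mathbf{i}\odot\mathbf{r}^{\odot_*}\odot\mathbf{t}$ (well-defined under the hypotheses of the claim). *)

(* Defs.v *)
From HB Require Import structures.
From mathcomp Require Import all_boot all_order all_algebra.
From mathcomp Require Import all_classical.

Set Implicit Arguments.
Unset Strict Implicit.
Unset Printing Implicit Defensive.

Import Order.TTheory GRing.Theory.

Local Open Scope classical_set_scope.

Definition composable_for (C X : Type) (out : X -> C) (inputs : X -> seq C)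
    (x : X) (i : nat) (y : X) : Prop :=
  i < size (inputs x) /\ nth (out x) (inputs x) i = out y.

(* Nonsymmetric set-operads colored by C.  The carrier is the disjoint union of
   the C(n), the arity of x being the length of its word of input colors.
   Inputs are numbered from 0, so [pcomp x i y] is the composition of y at the
   (i+1)-st input of x.  The partial composition is a total function whose
   value is unspecified unless [i < arity x] and [out y] is the color of input
   i; no axiom constrains it outside of this domain. *)
Record coloredOperad (C : finType) := ColoredOperad {
  operad_car :> choiceType;
  out : operad_car -> C;
  inputs : operad_car -> seq C;
  unit_at : C -> operad_car;
  pcomp : operad_car -> nat -> operad_car -> operad_car;
  arity_gt0 : forall x, 0 < size (inputs x);
  out_unit_at : forall a, out (unit_at a) = a;
  inputs_unit_at : forall a, inputs (unit_at a) = [:: a];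
  out_pcomp : forall x i y, composable_for out inputs x i y ->
    out (pcomp x i y) = out x;
  inputs_pcomp : forall x i y, composable_for out inputs x i y ->
    inputs (pcomp x i y) =
      take i (inputs x) ++ inputs y ++ drop i.+1 (inputs x);
  pcomp1x : forall x, pcomp (unit_at (out x)) 0 x = x;
  pcompx1 : forall x i, i < size (inputs x) ->
    pcomp x i (unit_at (nth (out x) (inputs x) i)) = x;
  pcompA : forall x i y j z,
    composable_for out inputs x i y -> composable_for out inputs y j z ->
    pcomp (pcomp x i y) (i + j) z = pcomp x i (pcomp y j z);
  pcompAC : forall x i y j z, i < j ->
    composable_for out inputs x i y -> composable_for out inputs x j z ->
    pcomp (pcomp x j z) i y = pcomp (pcomp x i y) (j + size (inputs y)).-1 z
}.

Definition operad := coloredOperad unit.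

Section ColoredOperad.
Variables (C : finType) (O : coloredOperad C).

Definition arity (x : O) : nat := size (inputs x).

Definition locally_finite : Prop :=
  forall n, finite_set [set x : O | arity x = n].

Definition arity_part (S : set O) (n : nat) : set O :=
  [set x | S x /\ arity x = n].

(* The complete composition x o [y_0, ..., y_(n-1)], performed from the last
   input to the first one; meaningful when [map out ys = inputs x]. *)
Definition ccomp (x : O) (ys : seq O) : O :=
  foldr (fun p z => pcomp z p.1 p.2) x (zip (iota 0 (size ys)) ys).

End ColoredOperad.

Section Bud.
Variables (C : finType) (O : operad).

Record bud_car := BudElt {
  bud_val : C * O * seq C;
  _ : size bud_val.2 == arity bud_val.1.2
}.

HB.instance Definition _ := [isSub for bud_val].
HB.instance Definition _ := [Choice of bud_car by <:].

Definition bud_out (X : bud_car) : C := (val X).1.1.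
Definition bud_elt (X : bud_car) : O := (val X).1.2.
Definition bud_inputs (X : bud_car) : seq C := (val X).2.

Lemma size_unit_at (a : C) :
  size (a, unit_at O tt, [:: a]).2 == arity (a, unit_at O tt, [:: a]).1.2.
Proof. by rewrite /arity /= inputs_unit_at. Qed.

Definition bud_unit (a : C) : bud_car := BudElt (size_unit_at a).

(* [insubd X] returns its second argument whenever the word of colors has the
   right length, which is the case as soon as the composition is defined. *)
Definition bud_pcomp (X : bud_car) (i : nat) (Y : bud_car) : bud_car :=
  insubd X (bud_out X, pcomp (bud_elt X) i (bud_elt Y),
            take i (bud_inputs X) ++ bud_inputs Y ++ drop i.+1 (bud_inputs X)).

Lemma size_bud_inputs X : size (bud_inputs X) = arity (bud_elt X).
Proof. exact: (eqP (valP X)). Qed.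

Lemma operad_composable (x : O) i y : i < arity x ->
  composable_for (@out _ O) (@inputs _ O) x i y.
Proof. by move=> ?; split=> //; case: (nth _ _ _); case: (out y). Qed.

Let bud_composable := composable_for bud_out bud_inputs.

Lemma val_bud_pcomp X i Y : i < size (bud_inputs X) ->
  val (bud_pcomp X i Y) =
    (bud_out X, pcomp (bud_elt X) i (bud_elt Y),
     take i (bud_inputs X) ++ bud_inputs Y ++ drop i.+1 (bud_inputs X)).
Proof.
move=> iX; rewrite /bud_pcomp val_insubd ifT //=.
have iX' : i < arity (bud_elt X) by rewrite -size_bud_inputs.
rewrite /arity inputs_pcomp; last exact: operad_composable.
by rewrite !size_cat !size_take !size_drop !size_bud_inputs.
Qed.

Lemma bud_pcompE X i Y : i < size (bud_inputs X) ->
  [/\ bud_out (bud_pcomp X i Y) = bud_out X,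
      bud_elt (bud_pcomp X i Y) = pcomp (bud_elt X) i (bud_elt Y) &
      bud_inputs (bud_pcomp X i Y) =
       take i (bud_inputs X) ++ bud_inputs Y ++ drop i.+1 (bud_inputs X)].
Proof.
by move=> iX; rewrite /bud_out /bud_elt /bud_inputs val_bud_pcomp.
Qed.

Lemma bud_eq X Y : bud_out X = bud_out Y -> bud_elt X = bud_elt Y ->
  bud_inputs X = bud_inputs Y -> X = Y.
Proof.
rewrite /bud_out /bud_elt /bud_inputs => e1 e2 e3; apply: val_inj.
by case: (val X) (val Y) e1 e2 e3 => [[? ?] ?] [[? ?] ?] /= -> -> ->.
Qed.

Lemma bud_arity_gt0 X : 0 < size (bud_inputs X).
Proof. by rewrite size_bud_inputs arity_gt0. Qed.

Lemma bud_out_pcomp X i Y :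
  bud_composable X i Y -> bud_out (bud_pcomp X i Y) = bud_out X.
Proof. by case=> iX _; case: (bud_pcompE Y iX). Qed.

Lemma bud_inputs_pcomp X i Y : bud_composable X i Y ->
  bud_inputs (bud_pcomp X i Y) =
    take i (bud_inputs X) ++ bud_inputs Y ++ drop i.+1 (bud_inputs X).
Proof. by case=> iX _; case: (bud_pcompE Y iX). Qed.

Lemma bud_pcomp1x X : bud_pcomp (bud_unit (bud_out X)) 0 X = X.
Proof.
have [|e1 e2 e3] := @bud_pcompE (bud_unit (bud_out X)) 0 X; first by [].
apply: bud_eq; rewrite ?e1 ?e2 ?e3 //=; last by rewrite cats0.
by rewrite /bud_elt /=; have := pcomp1x (bud_elt X); case: (out _).
Qed.

Lemma bud_pcompx1 X i : i < size (bud_inputs X) ->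
  bud_pcomp X i (bud_unit (nth (bud_out X) (bud_inputs X) i)) = X.
Proof.
move=> iX; have [e1 e2 e3] := bud_pcompE (bud_unit (nth (bud_out X) (bud_inputs X) i)) iX.
apply: bud_eq; rewrite ?e1 ?e2 ?e3 //.
  have iX' : i < size (inputs (bud_elt X)) by move: iX; rewrite size_bud_inputs.
  rewrite {2}/bud_elt /=.
  by have := pcompx1 iX'; case: (nth _ _ _).
by rewrite /bud_inputs /= -drop_nth // cat_take_drop.
Qed.

Lemma bud_pcompA X i Y j Z : bud_composable X i Y -> bud_composable Y j Z ->
  bud_pcomp (bud_pcomp X i Y) (i + j) Z = bud_pcomp X i (bud_pcomp Y j Z).
Proof.
move=> [iX _] [jY _].
have [e1 e2 e3] := bud_pcompE Y iX.
have [f1 f2 f3] := bud_pcompE Z jY.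
have [g1 g2 g3] := bud_pcompE (bud_pcomp Y j Z) iX.
have ti : size (take i (bud_inputs X)) = i by rewrite size_take iX.
have ijXY : i + j < size (bud_inputs (bud_pcomp X i Y)).
  by rewrite e3 !size_cat ti ltn_add2l ltn_addr.
have [h1 h2 h3] := bud_pcompE Z ijXY.
apply: bud_eq.
- by rewrite h1 g1 e1.
- rewrite h2 g2 e2 f2 pcompA //; apply: operad_composable;
  by rewrite -size_bud_inputs.
- rewrite h3 g3 e3 f3 -addnS !take_cat !drop_cat ti.
  have lt0 m p : (m + p < m) = false by rewrite ltnNge leq_addr.
  rewrite !lt0 !addKn jY.
  rewrite -!catA; do 3!congr (_ ++ _).
  case: ltnP => // jY'; have -> : j.+1 = size (bud_inputs Y).
    by apply/eqP; rewrite eqn_leq jY' jY.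
  by rewrite subnn drop0 drop_size.
Qed.

Lemma bud_pcompAC X i Y j Z : i < j ->
  bud_composable X i Y -> bud_composable X j Z ->
  bud_pcomp (bud_pcomp X j Z) i Y =
    bud_pcomp (bud_pcomp X i Y) (j + size (bud_inputs Y)).-1 Z.
Proof.
move=> ij [iX _] [jX _].
have [e1 e2 e3] := bud_pcompE Y iX.
have [f1 f2 f3] := bud_pcompE Z jX.
set u := bud_inputs X in iX jX e3 f3 *.
have ti : size (take i u) = i by rewrite size_take iX.
have tj : size (take j u) = j by rewrite size_take jX.
have iXZ : i < size (bud_inputs (bud_pcomp X j Z)).
  by rewrite f3 size_cat tj ltn_addr.
have [g1 g2 g3] := bud_pcompE Y iXZ.
have [d jE] : exists d, j = (i + d).+1.
  by exists (j - i.+1); rewrite -addSn subnKC.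
have kE : (j + size (bud_inputs Y)).-1 = i + (size (bud_inputs Y) + d).
  by rewrite jE addSn /= -addnA (addnC d).
have dX : d < size (drop i.+1 u) by rewrite size_drop ltn_subRL addSn -jE.
have kXY : (j + size (bud_inputs Y)).-1 < size (bud_inputs (bud_pcomp X i Y)).
  by rewrite kE e3 !size_cat ti !ltn_add2l.
have [h1 h2 h3] := bud_pcompE Z kXY.
apply: bud_eq.
- by rewrite h1 g1 e1.
- rewrite h2 g2 e2 f2 pcompAC ?size_bud_inputs //; apply: operad_composable;
  by rewrite -size_bud_inputs.
- rewrite h3 g3 e3 f3 kE -!addnS !take_cat !drop_cat ti tj ij.
  have lt0 m p : (m + p < m) = false by rewrite ltnNge leq_addr.
  rewrite !lt0 !addKn !lt0.
  have -> : take i (take j u) = take i u by rewrite take_takel // ltnW.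
  rewrite -!catA; do 2!congr (_ ++ _).
  have -> : take d (drop i.+1 u) = drop i.+1 (take j u).
    by rewrite take_drop jE addnS addnC.
  have -> : drop d.+1 (drop i.+1 u) = drop j.+1 u.
    by rewrite drop_drop jE; congr drop; rewrite addnC addSn addnS.
  case: (ltnP i.+1 j) => // ji; have -> : j = i.+1.
    by apply/eqP; rewrite eqn_leq ji ij.
  rewrite subnn bud_arity_gt0 drop0 (@drop_oversize _ _ (take _ _)) //.
  by rewrite size_take_min geq_minl.
Qed.

Definition bud : coloredOperad C :=
  @ColoredOperad C bud_car bud_out bud_inputs bud_unit bud_pcomp
    bud_arity_gt0 (fun=> erefl) (fun=> erefl) bud_out_pcomp bud_inputs_pcomp
    bud_pcomp1x bud_pcompx1 bud_pcompA bud_pcompAC.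

End Bud.

Record budSystem := BudSystem {
  ground : operad;
  colors : finType;
  rules : set (bud colors ground);
  finite_rules : finite_set rules;
  initials : {set colors};
  terminals : {set colors}
}.
Arguments rules : clear implicits.

Definition bud_of (B : budSystem) : coloredOperad (colors B) :=
  bud (colors B) (ground B).

(* A leaf records its color, so that the one-leaf tree exists for each color;
   in a tree of [Free S] the color of a leaf child is forced by its parent. *)
Inductive tree (C X : Type) : Type :=
| Leaf of C
| Node of X & seq (tree C X).
Arguments Leaf {C X} _.
Arguments Node {C X} _ _.

HB.instance Definition _ (C X : Type) := gen_eqMixin (tree C X).
HB.instance Definition _ (C X : Type) := gen_choiceMixin (tree C X).

(* The lengths of the paths from the root to the leaves, from left to right. *)
Fixpoint leaf_depths (C X : Type) (t : tree C X) : seq nat :=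
  match t with
  | Leaf _ => [:: 0]
  | Node _ ts => map succn (flatten (map (@leaf_depths C X) ts))
  end.

Definition perfect (C X : Type) (t : tree C X) : Prop := constant (leaf_depths t).

Fixpoint tree_inputs (C X : Type) (t : tree C X) : seq C :=
  match t with
  | Leaf a => [:: a]
  | Node _ ts => flatten (map (@tree_inputs C X) ts)
  end.

Section Trees.
Variables (C : finType) (O : coloredOperad C).
Implicit Types (S : set O) (t : tree C O).

Definition tree_out t : C :=
  match t with
  | Leaf a => a
  | Node x _ => out x
  end.

(* The condition [map tree_out ts = inputs x] expresses both that a node
   labeled by x has [arity x] children and that the colors match. *)
Inductive Free S : set (tree C O) :=
| FreeLeaf a : Free S (Leaf a)
| FreeNode x ts : S x -> map tree_out ts = inputs x ->
    (forall t, t \in ts -> Free S t) -> Free S (Node x ts).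

Definition Free_perf S : set (tree C O) := [set t | Free S t /\ perfect t].

Fixpoint ev t : O :=
  match t with
  | Leaf a => unit_at O a
  | Node x ts => ccomp x (map ev ts)
  end.

Definition finitely_factorizes S : Prop :=
  forall x : O, finite_set [set t | Free S t /\ ev t = x].

End Trees.

Definition nonempty_words (C : finType) (T : {set C}) : set (seq C) :=
  [set w | w <> [::] /\ forall a, a \in w -> a \in T].

Section Series.
Local Open Scope ring_scope.
Variables (K : fieldType) (C : finType) (O : coloredOperad C).

Definition series : Type := O -> K.

Definition char_series (S : set O) : series := fun x => (x \in S)%:R.

(* The pairs (y, [:: z_1; ...; z_n]), with n the arity of y, such that the
   complete composition y o [z_1, ..., z_n] is defined and equal to x. *)
Definition decompositions (x : O) : set (O * seq O) :=
  [set p | map (@out C O) p.2 = inputs p.1 /\ x = ccomp p.1 p.2].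

(* The sum is finite when O is locally finite: see [finite_decompositions]. *)
Definition series_comp (f g : series) : series := fun x =>
  \sum_(p \in decompositions x) (f p.1 * \prod_(z <- p.2) g z).

Definition unit_series : series := char_series (range (@unit_at C O)).

Definition series_pow (f : series) (l : nat) : series :=
  iter l (series_comp f) unit_series.

(* Pointwise sums of families of series: [series_sum] is only meaningful for
   [summable] families, that is, if each coefficient is a finite sum. *)
Definition summable (J : choiceType) (A : set J) (F : J -> series) : Prop :=
  forall x, finite_set [set j | A j /\ F j x <> 0].

Definition series_sum (J : choiceType) (A : set J) (F : J -> series) : series :=
  fun x => \sum_(j \in A) F j x.

Definition series_star (f : series) : series :=
  series_sum [set: nat] (series_pow f).

End Series.

Section Sync.
Variables (K : fieldType) (B : budSystem).

Definition rules_series : series K (bud_of B) := char_series K (rules B).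

Definition units_series (A : {set colors B}) : series K (bud_of B) :=
  char_series K [set unit_at (bud_of B) a | a in [set` A]].

Definition sync : series K (bud_of B) :=
  series_comp
    (series_comp (units_series (initials B)) (series_star rules_series))
    (units_series (terminals B)).

End Sync.
Arguments rules_series : clear implicits.
Arguments units_series : clear implicits.
Arguments sync : clear implicits.

Definition sync_trees (B : budSystem) : set (tree (colors B) (bud_of B)) :=
  [set t | [/\ Free_perf (O := bud_of B) (rules B) t,
               tree_out t \in initials B &
               nonempty_words (terminals B) (tree_inputs t)]].
Arguments sync_trees : clear implicits.

Section Finiteness.
Variables (C : finType) (O : coloredOperad C).

Lemma inputs_ccomp (x : O) ys : map (@out C O) ys = inputs x ->
  inputs (ccomp x ys) = flatten (map (@inputs C O) ys).
Proof.
pose w n (ys : seq O) :=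
  foldr (fun p z => pcomp z p.1 p.2) x (zip (iota n (size ys)) ys).
suff H pre : inputs x = pre ++ map (@out C O) ys ->
    inputs (w (size pre) ys) = pre ++ flatten (map (@inputs C O) ys).
  by move=> ysE; apply: (H [::]).
elim: ys pre => [|y ys IH] pre /= E; first by rewrite /w.
have /IH : inputs x = rcons pre (out y) ++ map (@out C O) ys by rewrite cat_rcons.
rewrite size_rcons cat_rcons.
rewrite -[w (size pre) _]/(pcomp (w (size pre).+1 ys) (size pre) y) => E'.
rewrite inputs_pcomp.
  by rewrite E' take_size_cat // -cat_rcons drop_size_cat ?size_rcons.
split; rewrite E' ?size_cat /= ?addnS ?ltnS ?leq_addr //.
by rewrite nth_cat ltnn subnn.
Qed.

Lemma finite_bounded_seqs (T : choiceType) (A : set T) n : finite_set A ->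
  finite_set [set s : seq T | size s <= n /\ forall z, z \in s -> A z].
Proof.
move=> fA; elim: n => [|n IH].
  by apply: (@sub_finite_set _ _ [set [::]]) => // -[|z s] [].
apply: (@sub_finite_set _ _
  ([set [::]] `|` [set z :: s | z in A & s in
     [set s : seq T | size s <= n /\ forall z, z \in s -> A z]])).
  move=> [|z s] [/= sn sA]; first by left.
  right; exists z; first by apply: sA; rewrite mem_head.
  by exists s => //; split=> // y ys; apply: sA; rewrite in_cons ys orbT.
by rewrite finite_setU; split=> //; apply: finite_image2.
Qed.

Lemma finite_decompositions (x : O) :
  locally_finite O -> finite_set (decompositions x).
Proof.
move=> lf; pose A := [set y : O | arity y <= arity x].
have fA : finite_set A.
  apply: (@sub_finite_set _ _ (\bigcup_(n in `I_(arity x).+1)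
      [set y : O | arity y = n])).
    by move=> y yx; exists (arity y) => //=; rewrite ltnS.
  by apply: bigcup_finite => // n _; apply: lf.
apply: (@sub_finite_set _ _ (A `*`
  [set s : seq O | size s <= arity x /\ forall z, z \in s -> A z])); last first.
  by apply: finite_setX => //; apply: finite_bounded_seqs.
move=> [y zs] [/= zsE xE].
have ax : arity x = \sum_(z <- zs) arity z.
  rewrite xE /arity inputs_ccomp // size_flatten /shape -map_comp.
  by rewrite sumnE big_map.
have szs : size zs <= arity x.
  rewrite ax -sum1_size; apply: leq_sum => z _; exact: arity_gt0.
split=> /=; first by rewrite /A /= {1}/arity -zsE size_map.
split=> // z zzs; rewrite /A /= ax (big_rem z) //=; exact: leq_addr.
Qed.

End Finiteness.

Lemma bud_locally_finite (C : finType) (O : operad) :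
  locally_finite O -> locally_finite (bud C O).
Proof.
move=> lf n.
set W := [set u : seq C | size u <= n /\ forall a, a \in u -> [set: C] a].
have fW : finite_set W by apply: finite_bounded_seqs; apply: finite_finset.
have fP := finite_setX (finite_setX (@finite_finset _ [set: C]) (lf n)) fW.
apply: (sub_finite_set _ (finite_preimage (f := @bud_val C O) _ fP)).
  move=> X /= Xn; have e := size_bud_inputs X.
  have Xn' : size (bud_inputs X) = n by [].
  by split; [split=> //=; rewrite -[LHS]e | split; rewrite ?[size _]Xn'].
by move=> X Y _ _ /val_inj.
Qed.

(* Main.v *)
Require Import Defs.
From mathcomp Require Import all_boot all_order all_algebra.
From mathcomp Require Import all_classical.

Import GRing.Theory.
Local Open Scope classical_set_scope.
Local Open Scope ring_scope.

Set Implicit Arguments.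
Unset Strict Implicit.

(** Call a tree perfect of height l when all its leaves have depth l.  Writing r
    for the characteristic series of the set S of rules, the coefficient of x in
    the l-th power of r counts the perfect S-trees of height l that evaluate
    to x ([series_pow_gen]): a perfect tree of height l + 1 is a root labeled by
    a rule together with a word of perfect trees of height l, and expanding the
    product that defines the composition of two series enumerates exactly these
    data.  Summing over l, the star of r counts all perfect trees
    ([series_star_gen]); composing with i on the left and with t on the right
    selects the trees whose output color is initial ([units_comp_star]) and
    whose input colors are terminal ([comp_units]).

    All of this is bookkeeping on series that sum the values of a map e over a
    set A of indices ([gen_series]).  If such maps have finite fibers, the
    composition of two of these series is again of this form, indexed by the
    pairs of an index of the first series and a word of indices of the second
    one whose colors match ([series_comp_gen]); every identity above is then a
    bijection between sets of indices ([gen_series_bij]).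

    Finiteness of the fibers of evaluation ([Free_finitely_factorizes]) is where
    the hypothesis on unary rules enters.  There are finitely many elements of
    arity 1, so the trees made of unary rules only are finite in number
    ([finite_unary_trees]).  A tree with at most n + 1 leaves is obtained
    from such a tree by replacing its leaf by a leaf or by a tree whose root has
    arity at least 2, so that all the children of this root have at most n
    leaves ([unary_decomposition]); hence, by induction,
    finitely many trees have a given number of leaves, which is the arity of
    their evaluation. *)

(** * Complete compositions *)

Section CompleteComposition.
Local Open Scope nat_scope.
Context {C : finType} {O : coloredOperad C}.
Implicit Types (x y : O) (ys : seq O).

Lemma out_ccomp x ys : map (@out C O) ys = inputs x -> out (ccomp x ys) = out x.
Proof.
pose w n (ys : seq O) :=
  foldr (fun p z => Defs.pcomp z p.1 p.2) x (zip (iota n (size ys)) ys).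
suff H pre : inputs x = pre ++ map (@out C O) ys ->
    out (w (size pre) ys) = out x /\
    inputs (w (size pre) ys) = pre ++ flatten (map (@inputs C O) ys).
  by move=> ysE; case: (H [::]).
elim: ys pre => [|y ys IH] pre /= E; first by rewrite /w.
have /IH : inputs x = rcons pre (out y) ++ map (@out C O) ys by rewrite cat_rcons.
rewrite size_rcons cat_rcons => -[outE inE].
rewrite -[w (size pre) _]/(Defs.pcomp (w (size pre).+1 ys) (size pre) y).
have comp : composable_for (@out C O) (@inputs C O)
    (w (size pre).+1 ys) (size pre) y.
  split; rewrite inE ?size_cat /= ?addnS ?ltnS ?leq_addr //.
  by rewrite nth_cat ltnn subnn.
rewrite out_pcomp // inputs_pcomp // inE; split=> //.
by rewrite take_size_cat // -cat_rcons drop_size_cat ?size_rcons.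
Qed.

Lemma ccomp_unit_left x : ccomp (unit_at O (out x)) [:: x] = x.
Proof. exact: pcomp1x. Qed.

Lemma ccomp_units x : ccomp x (map (unit_at O) (inputs x)) = x.
Proof.
pose w n (ys : seq O) :=
  foldr (fun p z => Defs.pcomp z p.1 p.2) x (zip (iota n (size ys)) ys).
suff H pre u : inputs x = pre ++ u -> w (size pre) (map (unit_at O) u) = x.
  exact: (H [::]).
elim: u pre => [|a u IH] pre /= E; first by rewrite /w.
have /IH : inputs x = rcons pre a ++ u by rewrite cat_rcons.
rewrite size_rcons.
rewrite -[w (size pre) _]/(Defs.pcomp (w (size pre).+1 (map (unit_at O) u))
  (size pre) (unit_at O a)) => ->.
have aE : nth (out x) (inputs x) (size pre) = a by rewrite E nth_cat ltnn subnn.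
by rewrite -{1}aE pcompx1 // E size_cat /= addnS ltnS leq_addr.
Qed.

End CompleteComposition.

(** * Evaluation and height of syntax trees *)

Section SyntaxTrees.
Local Open Scope nat_scope.
Context {C : finType} {O : coloredOperad C}.
Variable S : set O.
Implicit Types (t : tree C O) (x : O).

Lemma Free_out_inputs_ev t : Free S t ->
  out (ev t) = tree_out t /\ inputs (ev t) = tree_inputs t.
Proof.
elim=> [a|x ts Sx tsE _ IH] /=; first by rewrite out_unit_at inputs_unit_at.
have outE : map (@out C O) (map (@ev C O) ts) = inputs x.
  by rewrite -map_comp -tsE; apply/eq_in_map => u /IH[].
rewrite out_ccomp // inputs_ccomp // -map_comp; split=> //.
by congr flatten; apply/eq_in_map => u /IH[].
Qed.

Lemma Free_out_ev t : Free S t -> out (ev t) = tree_out t.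
Proof. by case/Free_out_inputs_ev. Qed.

Lemma Free_inputs_ev t : Free S t -> inputs (ev t) = tree_inputs t.
Proof. by case/Free_out_inputs_ev. Qed.

Lemma size_tree_inputs_gt0 t : Free S t -> 0 < size (tree_inputs t).
Proof. by move=> /Free_inputs_ev <-; apply: arity_gt0. Qed.

Lemma size_leaf_depths t : size (leaf_depths t) = size (tree_inputs t).
Proof.
move: t; fix IH 1 => -[a|x ts] //=.
rewrite size_map !size_flatten /shape -!map_comp; congr sumn.
elim: ts => //= t ts ->; congr (_ :: _); exact: IH.
Qed.

(** The depth of the leftmost leaf, which is the height of the tree when it is
    perfect.  The default value 0 is irrelevant on the trees of [Free S], as they
    all have a leaf. *)
Definition tree_height t : nat := head 0 (leaf_depths t).

(** The perfect S-trees of height l. *)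
Definition perf_of_height (l : nat) : set (tree C O) :=
  [set t | Free S t /\ all (pred1 l) (leaf_depths t)].

Lemma Free_perfP t : Free_perf S t <-> exists l, perf_of_height l t.
Proof.
split=> [[St pt]|[l [St lt]]].
  move: pt (size_tree_inputs_gt0 St); rewrite -size_leaf_depths /perfect.
  case E: (leaf_depths t) => [|l s] //= ls _.
  by exists l; split; rewrite // E /= eqxx.
split=> //; rewrite /perfect; move: lt.
by case: (leaf_depths t) => //= k s /andP[/eqP ->].
Qed.

Lemma perf_of_heightE l t : perf_of_height l t -> tree_height t = l.
Proof.
move=> [St lt]; move: lt (size_tree_inputs_gt0 St).
rewrite -size_leaf_depths /tree_height.
by case: (leaf_depths t) => //= k s /andP[/eqP].
Qed.

Lemma perf_of_height0 t : perf_of_height 0 t <-> exists a, t = Leaf a.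
Proof.
split=> [[]|[a ->]]; last by split=> //; apply: FreeLeaf.
case: t => [a|x ts] St; first by exists a.
move: (size_tree_inputs_gt0 St); rewrite -size_leaf_depths /= size_map.
by case: flatten.
Qed.

Lemma perf_of_heightS l t : perf_of_height l.+1 t <->
  exists x ts, [/\ t = Node x ts, S x, map (@tree_out C O) ts = inputs x &
    forall s, s \in ts -> perf_of_height l s].
Proof.
have allE ts : all (pred1 l.+1) (map succn (flatten (map (@leaf_depths C O) ts))) =
    all (fun t => all (pred1 l) (leaf_depths t)) ts.
  by elim: ts => //= t' ts <-; rewrite map_cat all_cat all_map.
split=> [[]|[x [ts [-> Sx tsE H]]]].
  case=> [a|x ts Sx tsE Sts] //=; rewrite allE => /allP lts.
  by exists x, ts; split=> // s s_ts; split; [apply: Sts|apply: lts].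
split; first by apply: FreeNode => // s /H[].
by rewrite /= allE; apply/allP => s /H[].
Qed.

End SyntaxTrees.

(** * Finiteness of the set of trees with a given evaluation *)

Section Finiteness.
Local Open Scope nat_scope.
Context {C : finType} {O : coloredOperad C}.
Variable S : set O.
Implicit Types (t s b : tree C O) (x : O).

(** The tree obtained by replacing every leaf of s by b; it is only used when s
    has a single leaf. *)
Fixpoint graft s b : tree C O :=
  match s with
  | Leaf _ => b
  | Node x ss => Node x (map (graft^~ b) ss)
  end.

(** Each of the other children has a leaf too. *)
Lemma size_child_lt t ts : (forall t, t \in ts -> Free S t) -> 1 < size ts ->
  t \in ts -> size (tree_inputs t) <
  size (flatten (map (@tree_inputs C O) ts)).
Proof.
move=> Sts ts1 t_ts; rewrite size_flatten /shape -map_comp sumnE big_map.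
rewrite (big_rem t) //= -[X in X < _]addn0 ltn_add2l.
have: size (rem t ts) <= \sum_(s <- rem t ts) size (tree_inputs s).
  rewrite -sum1_size big_seq [X in _ <= X]big_seq; apply: leq_sum => s.
  by move/mem_rem/Sts/size_tree_inputs_gt0.
by apply: leq_trans; rewrite size_rem //; case: (size ts) ts1 => [|[]].
Qed.

Lemma finite_unary_trees : locally_finite O ->
  finitely_factorizes (arity_part S 1) -> finite_set (Free (arity_part S 1)).
Proof.
move=> lf ff.
apply: (@sub_finite_set _ _ (\bigcup_(x in [set x : O | arity x = 1])
    [set t | Free (arity_part S 1) t /\ ev t = x])); last first.
  by apply: bigcup_finite => // x _; apply: ff.
move=> t St; exists (ev t) => //=; rewrite /arity (Free_inputs_ev St).
elim: St => [//|x ts [_ ax] tsE _ IH] /=.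
move: (congr1 size tsE); rewrite size_map -/(arity x) ax.
case: ts IH {tsE} => [|t' []] // IH _ /=.
by rewrite cats0; apply: IH; rewrite mem_head.
Qed.

(** Splits off the maximal chain s of unary nodes at the root of t.  The color of
    the leaf of s plays no role in [graft], but the output color of s is needed
    for the chain to be extended by one more node. *)
Lemma unary_decomposition n t : Free S t -> size (tree_inputs t) <= n.+1 ->
  exists s b, [/\ Free (arity_part S 1) s, tree_out s = tree_out t,
    t = graft s b &
    (exists a, b = Leaf a) \/ exists x ts, [/\ b = Node x ts, S x,
      size ts <= n.+1 &
      forall u, u \in ts -> Free S u /\ size (tree_inputs u) <= n]].
Proof.
elim=> [a|x ts Sx tsE Sts IH] /= tn.
  by exists (Leaf a), (Leaf a); split=> //; [apply: FreeLeaf|left; exists a].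
have sE : size ts = arity x by rewrite /arity -tsE size_map.
have [x1|x1] := eqVneq (arity x) 1.
  move: sE; rewrite x1; case: ts tsE Sts IH tn => [|u []] //= uE _ IH un _.
  have [||s [b [Ss outs uE' Hb]]] := IH u; first by rewrite mem_head.
    by rewrite cats0 in un.
  exists (Node x [:: s]), b; split=> //=; last by rewrite -uE'.
  apply: FreeNode => //=; first by rewrite outs.
  by move=> v; rewrite inE => /eqP ->.
have ts1 : 1 < size ts.
  by rewrite sE ltn_neqAle eq_sym x1 /=; apply: arity_gt0.
exists (Leaf (out x)), (Node x ts); split=> //; first exact: FreeLeaf.
right; exists x, ts; split=> //.
  apply: leq_trans tn; rewrite size_flatten /shape -map_comp sumnE big_map.
  rewrite -sum1_size big_seq [X in _ <= X]big_seq; apply: leq_sum => u.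
  by move/Sts/size_tree_inputs_gt0.
move=> u uts; split; first exact: Sts.
by rewrite -ltnS; apply: leq_trans tn; apply: size_child_lt.
Qed.

Lemma finite_Free_leaves n : locally_finite O -> finite_set S ->
  finitely_factorizes (arity_part S 1) ->
  finite_set [set t | Free S t /\ size (tree_inputs t) <= n].
Proof.
move=> lf fS ff; elim: n => [|n IH].
  apply: (@sub_finite_set _ _ set0) => // t [/size_tree_inputs_gt0].
  by case: size.
have fU := finite_unary_trees lf ff.
(* The trees that can stand above a maximal chain of unary nodes. *)
pose tops : set (tree C O) := [set Leaf a | a in [set: C]] `|`
  [set Node x ts | x in S & ts in [set ts : seq (tree C O) | size ts <= n.+1 /\
     forall u, u \in ts -> [set t | Free S t /\ size (tree_inputs t) <= n] u]].
apply: (@sub_finite_set _ _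
  [set graft s b | s in Free (arity_part S 1) & b in tops]).
  move=> t [/= St tn].
  have [s [b [Ss _ -> Hb]]] := unary_decomposition St tn.
  exists s => //; exists b => //.
  case: Hb => [[a ->]|[x [ts [-> Sx tsn Hts]]]]; first by left; exists a.
  by right; exists x => //; exists ts.
apply: finite_image2 => //; rewrite finite_setU; split.
  by apply: finite_image; apply: finite_finset.
by apply: finite_image2 => //; apply: finite_bounded_seqs.
Qed.

Lemma Free_finitely_factorizes : locally_finite O -> finite_set S ->
  finitely_factorizes (arity_part S 1) -> finitely_factorizes S.
Proof.
move=> lf fS ff x.
apply: sub_finite_set (finite_Free_leaves (arity x) lf fS ff) => t [St <-] /=.
by rewrite /arity (Free_inputs_ev St).
Qed.

End Finiteness.

(** * Series of the values of a map *)

Section GeneratingSeries.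
Context {K : fieldType} {C : finType} {O : coloredOperad C}.

(** The sum of the elements e j for j in A, so that the coefficient of x is the
    number of indices j in A with e j = x.  As infinite sums take the value 0,
    this is only meaningful when e has finite fibers on A. *)
Definition gen_series (J : choiceType) (A : set J) (e : J -> O) : series K O :=
  series_sum A (fun j => char_series K [set e j]).

Definition finite_fibers (J : choiceType) (A : set J) (e : J -> O) : Prop :=
  forall x, finite_set [set j | A j /\ e j = x].

Lemma char_series_set1 (x y : O) : char_series K [set x] y = (y == x)%:R.
Proof.
rewrite /char_series; case: eqVneq => [->|yx]; first by rewrite mem_set.
by rewrite memNset // => /eqP; apply/negP.
Qed.

Lemma gen_seriesE (J : choiceType) (A : set J) (e : J -> O) x :
  gen_series A e x = \sum_(j \in [set j | A j /\ e j = x]) (1 : K).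
Proof.
have -> : [set j | A j /\ e j = x] = A `&` e @^-1` [set x] by [].
rewrite fsbig_mkcondr; apply: eq_fsbigr => j _; rewrite char_series_set1.
case: eqVneq => [->|xNe]; first by rewrite mem_set.
by rewrite memNset // => /= /esym/eqP; apply/negP.
Qed.

Lemma gen_series_bij (I J : choiceType) (h : I -> J) (A : set I) (B : set J)
    (e : I -> O) (e' : J -> O) :
  set_bij A B h -> (forall i, A i -> e' (h i) = e i) ->
  gen_series B e' = gen_series A e.
Proof.
move=> hAB eE; rewrite /gen_series /series_sum; apply/funext => x.
rewrite (reindex_fsbig h A B) //; apply: eq_fsbigr => i /set_mem Ai.
by rewrite eE.
Qed.

(** Partition of a finite sum along the fibers of f; the index set D may be
    infinite, since the fibers outside of the image of f are empty. *)
Lemma fsbig_fibers (I J : choiceType) (Y : set J) (D : set I) (f : J -> I)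
    (F : J -> K) : finite_set Y -> (forall q, Y q -> D (f q)) ->
  \sum_(p \in D) \sum_(q \in [set q | Y q /\ f q = p]) F q = \sum_(q \in Y) F q.
Proof.
move=> fY YD.
rewrite -(@fsbig_widen _ _ _ _ (f @` Y)); first last.
- move=> p [_ Np] /=; apply: fsbig1 => q [Yq fq].
  by case: Np; exists q.
- by move=> p [q Yq <-]; apply: YD.
have E p : \sum_(q \in [set q | Y q /\ f q = p]) F q =
    \sum_(q \in Y) if q \in f @^-1` [set p] then F q else 0.
  by rewrite -fsbig_mkcondr.
under eq_fsbigr do rewrite E.
rewrite exchange_fsbig //; last exact: finite_image.
apply: eq_fsbigr => q /set_mem Yq.
rewrite -(@fsbig_widen _ _ _ _ [set f q]); first last.
- move=> p [_ Np] /=; rewrite memNset //= => E'; exact/Np/esym.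
- by move=> _ ->; exists q.
by rewrite fsbig_set1 mem_set.
Qed.

Lemma finite_seq_fibers (J : choiceType) (A : set J) (e : J -> O) zs :
  finite_fibers A e ->
  finite_set [set js | (forall j, j \in js -> A j) /\ map e js = zs].
Proof.
move=> fA; elim: zs => [|z zs IH].
  by apply: (@sub_finite_set _ _ [set [::]]) => // -[|j js] [].
apply: (@sub_finite_set _ _ [set j :: js | j in [set j | A j /\ e j = z] &
    js in [set js | (forall j, j \in js -> A j) /\ map e js = zs]]).
  move=> [|j js] [] //= Ajs [ej ejs]; exists j.
    by split=> //; apply: Ajs; rewrite mem_head.
  by exists js => //; split=> // k kjs; apply: Ajs; rewrite in_cons kjs orbT.
exact: finite_image2.
Qed.

(** Expanding the product: it counts the words of indices with values zs. *)
Lemma prod_gen_series (J : choiceType) (A : set J) (e : J -> O) zs :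
  finite_fibers A e ->
  \prod_(z <- zs) gen_series A e z =
  \sum_(js \in [set js | (forall j, j \in js -> A j) /\ map e js = zs]) (1 : K).
Proof.
move=> fA; elim: zs => [|z zs IH].
  rewrite big_nil (_ : [set js | _] = [set [::]]) ?fsbig_set1 //.
  by apply/seteqP; split=> [[|j js] []|_ ->].
rewrite big_cons IH gen_seriesE mulr_fsuml.
under eq_fsbigr do rewrite mul1r.
rewrite pair_fsbig //; last exact: finite_seq_fibers.
rewrite [RHS](reindex_fsbig (fun p : J * seq J => p.1 :: p.2)
  ([set j | A j /\ e j = z] `*`
   [set js | (forall j, j \in js -> A j) /\ map e js = zs])) //.
split=> [[j js] [/= [Aj ej] [Ajs ejs]]|[j js] [k ks] _ _ [-> ->]|[|j js] []] //=.
  by split; [move=> k; rewrite inE => /predU1P[->|/Ajs]|rewrite ej ejs].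
move=> Ajs [ej ejs]; exists (j, js) => //; split=> /=.
  by split=> //; apply: Ajs; rewrite mem_head.
by split=> // k kjs; apply: Ajs; rewrite in_cons kjs orbT.
Qed.

(** The pairs of an index i in A and a word of indices j in B such that the
    complete composition of e i with the word of the values e' j is defined. *)
Definition comp_index (I J : choiceType) (A : set I) (e : I -> O)
    (B : set J) (e' : J -> O) : set (I * seq J) :=
  [set q | [/\ A q.1, forall j, j \in q.2 -> B j &
               map (@out C O \o e') q.2 = inputs (e q.1)]].

Lemma series_comp_gen (I J : choiceType) (A : set I) (e : I -> O)
    (B : set J) (e' : J -> O) :
  locally_finite O -> finite_fibers A e -> finite_fibers B e' ->
  series_comp (gen_series A e) (gen_series B e') =
  gen_series (comp_index A e B e') (fun q => ccomp (e q.1) (map e' q.2)).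
Proof.
move=> lf fA fB; apply/funext => x; rewrite gen_seriesE /series_comp.
(* The indices above the decomposition p of x. *)
pose fib p := [set i | A i /\ e i = p.1] `*`
  [set js | (forall j, j \in js -> B j) /\ map e' js = p.2].
have ffib p : finite_set (fib p).
  by apply: finite_setX => //; apply: finite_seq_fibers.
set Y := [set q | _].
pose f (q : I * seq J) := (e q.1, map e' q.2).
have YD q : Y q -> decompositions x (f q).
  by move=> [[_ _ E] <-]; rewrite map_comp in E.
have fibE p : decompositions x p -> [set q | Y q /\ f q = p] = fib p.
  case: p => y zs [/= zsE xE]; apply/seteqP; split=> [[i js]|[i js]] /=.
    by move=> [[[/= Ai Bjs E] _] [<- <-]].
  move=> [[/= Ai ei] [Bjs ejs]]; rewrite /f /= ei ejs; split=> //.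
  by split=> //=; [split=> //=; rewrite map_comp ejs ei|rewrite ei ejs].
have fY : finite_set Y.
  apply: (@sub_finite_set _ _ (\bigcup_(p in decompositions x) fib p)).
    by move=> q Yq; exists (f q); [apply: YD|rewrite -fibE //; apply: YD].
  by apply: bigcup_finite => //; apply: finite_decompositions.
rewrite -(fsbig_fibers _ fY YD); apply: eq_fsbigr => p /set_mem Dp.
rewrite fibE // prod_gen_series // gen_seriesE mulr_fsuml.
under eq_fsbigr do rewrite mul1r.
by rewrite pair_fsbig //; apply: finite_seq_fibers.
Qed.

Lemma gen_series_neq0 (J : choiceType) (A : set J) (e : J -> O) x :
  gen_series A e x <> 0 -> exists2 j, A j & e j = x.
Proof.
apply: contra_notP => H; rewrite gen_seriesE; apply: fsbig1 => j [Aj ej].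
by case: H; exists j.
Qed.

Lemma char_series_image (J : choiceType) (A : set J) (e : J -> O) :
  {in A &, injective e} -> char_series K (e @` A) = gen_series A e.
Proof.
move=> inj; apply/funext => x; rewrite gen_seriesE /char_series.
case: (asboolP ((e @` A) x)) => [[j Aj <-]|Nx].
  rewrite mem_set; last by exists j.
  rewrite (_ : [set k | _] = [set j]) ?fsbig_set1 //.
  apply/seteqP; split=> [k [Ak ek]|_ ->] //=.
  by apply: inj => //; apply: mem_set.
by rewrite memNset // fsbig1 // => j [Aj ej]; case: Nx; exists j.
Qed.

End GeneratingSeries.
(** * Powers of the series of rules *)

Section Powers.
Context {K : fieldType} {C : finType} {O : coloredOperad C}.
Variable S : set O.
Hypotheses (lf : locally_finite O) (ffS : finitely_factorizes S).

Lemma unit_at_inj : injective (unit_at O).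
Proof. by move=> a b /(congr1 (@out C O)); rewrite !out_unit_at. Qed.

Lemma finite_fibers_inj (J : choiceType) (A : set J) (e : J -> O) :
  injective e -> finite_fibers A e.
Proof.
move=> inj x; case: (pselect (exists j, e j = x)) => [[j <-]|Nx].
  by apply: (@sub_finite_set _ _ [set j]) => // k [_ /inj].
by apply: (@sub_finite_set _ _ set0) => // k [_ ek]; case: Nx; exists k.
Qed.

Lemma finite_fibers_ev (A : set (tree C O)) :
  A `<=` Free S -> finite_fibers A (@ev C O).
Proof.
by move=> AS x; apply: sub_finite_set (ffS x) => t [/AS].
Qed.

Lemma perf_of_height_Free l : perf_of_height S l `<=` Free S.
Proof. by move=> t []. Qed.

Lemma unit_series_gen :
  @unit_series K C O = gen_series (perf_of_height S 0) (@ev C O).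
Proof.
rewrite /unit_series char_series_image; last by move=> a b _ _ /unit_at_inj.
apply/esym/(gen_series_bij (h := Leaf)) => //.
split=> [a _|a b _ _ []|t /perf_of_height0[a ->]] //.
by apply/perf_of_height0; exists a.
Qed.

Lemma series_pow_gen l : series_pow (char_series K S) l =
  gen_series (perf_of_height S l) (@ev C O).
Proof.
elim: l => [|l IH]; first exact: unit_series_gen.
rewrite /series_pow iterS -/(series_pow _ l) IH.
rewrite -[X in char_series _ X]image_id char_series_image; last by [].
rewrite series_comp_gen //; last 2 first.
- exact: finite_fibers_inj.
- exact/finite_fibers_ev/perf_of_height_Free.
have outE ts : (forall t, t \in ts -> perf_of_height S l t) ->
    map (@out C O \o @ev C O) ts = map (@tree_out C O) ts.
  by move=> H; apply/eq_in_map => t /H[/Free_out_ev].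
apply/esym/(gen_series_bij (h := fun q => Node q.1 q.2)) => //.
split=> [[x ts] [/= Sx Hts E]|[x ts] [y us] _ _ [-> ->]|t] //=.
  by apply/perf_of_heightS; exists x, ts; rewrite -outE.
move=> /perf_of_heightS[x [ts [-> Sx E Hts]]].
by exists (x, ts) => //; split=> //=; rewrite outE.
Qed.

Lemma summable_pow : summable [set: nat] (series_pow (char_series K S)).
Proof.
move=> x; apply: sub_finite_set (finite_image (@tree_height C O) (ffS x)).
move=> l [_]; rewrite series_pow_gen => /gen_series_neq0[t lt evt].
by exists t; [split=> //; case: lt|apply: perf_of_heightE lt].
Qed.

Lemma series_star_gen :
  series_star (char_series K S) = gen_series (Free_perf S) (@ev C O).
Proof.
apply/funext => x; rewrite gen_seriesE /series_star /series_sum.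
set Y := [set t | _].
have fY : finite_set Y by apply: sub_finite_set (ffS x) => t [[]].
rewrite -(@fsbig_fibers K _ _ Y [set: nat] (@tree_height C O)) //.
apply: eq_fsbigr => l _; rewrite series_pow_gen gen_seriesE; apply: eq_fsbigl.
apply/seteqP; split=> t /=.
  move=> [lt evt]; rewrite (perf_of_heightE lt); split=> //; split=> //.
  by apply/Free_perfP; exists l.
by move=> [[/Free_perfP[m mt] evt] <-]; rewrite (perf_of_heightE mt).
Qed.

(** Composing with units on the left filters by output color: the indices of the
    composition are the pairs of the output color of a tree and the one-letter
    word made of this tree. *)
Lemma units_comp_star (I : set C) :
  series_comp (char_series K (unit_at O @` I)) (series_star (char_series K S)) =
  gen_series [set t | Free_perf S t /\ I (tree_out t)] (@ev C O).
Proof.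
rewrite series_star_gen char_series_image; last by move=> a b _ _ /unit_at_inj.
rewrite series_comp_gen //; last 2 first.
- exact/finite_fibers_inj/unit_at_inj.
- by apply: finite_fibers_ev => t [].
apply: (gen_series_bij (h := fun t => (tree_out t, [:: t]))) => /=; last first.
  by move=> t [[St _] _]; rewrite -(Free_out_ev St) ccomp_unit_left.
split=> [t [pt It]|t u _ _ []|[a ts] [/= Ia Hts]] //.
  split=> //=; first by move=> u; rewrite inE => /eqP ->.
  by rewrite inputs_unit_at; case: pt => /Free_out_ev ->.
rewrite inputs_unit_at; case: ts Hts => [|t []] //= Hts [].
have pt : Free_perf S t by apply: Hts; rewrite mem_head.
case: (pt) => /Free_out_ev -> _ E; exists t; last by rewrite E.
by split=> //; rewrite E.
Qed.

(** Composing with units on the right filters by input colors: the indices of the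
    composition are the pairs of a tree and its word of input colors. *)
Lemma comp_units (A : set (tree C O)) (T : set C) : A `<=` Free S ->
  series_comp (gen_series A (@ev C O)) (char_series K (unit_at O @` T)) =
  gen_series [set t | A t /\ forall a, a \in tree_inputs t -> T a] (@ev C O).
Proof.
move=> AS; rewrite char_series_image; last by move=> a b _ _ /unit_at_inj.
rewrite series_comp_gen //; last 2 first.
- exact: finite_fibers_ev.
- exact/finite_fibers_inj/unit_at_inj.
have outE (u : seq C) : map (@out C O \o unit_at O) u = u.
  by rewrite -[RHS]map_id; apply: eq_map => a /=; rewrite out_unit_at.
apply: (gen_series_bij (h := fun t => (t, tree_inputs t))) => /=; last first.
  by move=> t [/AS St _]; rewrite -(Free_inputs_ev St) ccomp_units.
split=> [t [At Tt]|t u _ _ []|[t u] [/= At Tu]] //.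
  by split=> //=; rewrite outE (Free_inputs_ev (AS _ At)).
by rewrite outE (Free_inputs_ev (AS _ At)) => uE; exists t; rewrite uE in Tu *.
Qed.

End Powers.

(** * The synchronous generating series *)

Theorem theorem3p4p4 (K : fieldType) (K_char0 : [pchar K] =i pred0)
    (B : budSystem) (lf_ground : locally_finite (ground B))
    (ff_rules1 : finitely_factorizes (arity_part (O := bud_of B) (rules B) 1)) :
  [/\ summable [set: nat] (series_pow (rules_series K B)),
      summable (sync_trees B)
        (fun t => char_series K [set ev (O := bud_of B) t]) &
      sync K B =
        series_sum (sync_trees B)
          (fun t => char_series K [set ev (O := bud_of B) t])].
Proof.
have lf : locally_finite (bud_of B) by apply: bud_locally_finite.
have ffS : finitely_factorizes (O := bud_of B) (rules B).
  exact: Free_finitely_factorizes lf (@finite_rules B) ff_rules1.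
split.
- exact: summable_pow.
- move=> x; apply: sub_finite_set (ffS x) => t [[[St _] _ _]].
  by rewrite char_series_set1 => H; split=> //; case: eqVneq H.
- rewrite /sync /units_series /rules_series units_comp_star //.
  rewrite (comp_units lf ffS); last by move=> t [[]].
  rewrite -[RHS]/(gen_series (sync_trees B) (@ev _ _)).
  congr gen_series; apply/seteqP; split=> t /=.
    (* The word of input colors of a tree is never empty. *)
    move=> [[pt It] Tt]; split=> //; split=> // E.
    by case: pt => /size_tree_inputs_gt0; rewrite E.
  by move=> [pt It [_ Tt]].
Qed.
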